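(* Let $n\ge2$ and consider the star graph with a central node $0$ connected by an edge to each of $n$ leaf nodes $1,\dots,n$ (and no other edges), with starting node $X_0=0$. Then $$\mathbb E_{\pi_{neg}}[T_C]=2n-1,\qquad \mathbb E_{\pi_{rw}}[T_C]=2n\Big(\sum_{i=1}^n\frac1i\Big)-1.$$ In particular the cover time under the negative feedback policy is strictly smaller than under the random walk policy.
   Context: $T_C$ is the smallest $m$ such that $X_0,\dots,X_m$ visit all nodes of the graph; $\mathbb E_\pi[T_C]$ is the cover time under policy $\pi$. Random walk $\pi_{rw}$: if $X_m=i$, $X_{m+1}$ is a uniformly random neighbour of $i$, independently of the past. Negative feedback $\pi_{neg}$: for an edge from $i$ to $j$, let $N_{ij}^{(m)}$ be the number of times $t<m$ with $X_t=i,X_{t+1}=j$. Let $Smin_i^{(m)}$ be the set of neighbours $j$ of $i$ minimizing $N_{ij}^{(m)}$. If $X_m=i$, then given the past, $X_{m+1}$ is uniformly distributed on $Smin_i^{(m)}$. *)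

(* Defs.v *)
From mathcomp Require Import all_boot all_order all_algebra.
From mathcomp Require Import all_classical all_reals all_analysis.

Set Implicit Arguments.
Unset Strict Implicit.
Unset Printing Implicit Defensive.

Import Order.TTheory GRing.Theory Num.Theory.
Local Open Scope classical_set_scope.
Local Open Scope ring_scope.

Definition neighbours (V : finType) (e : rel V) (i : V) : {set V} :=
  [set j | e i j]%SET.

(* A policy maps a trajectory x and a time m to the conditional law of X_{m+1}
   given X_0 = x 0, ..., X_m = x m; the policies below only look at x up to
   time m. *)
Definition policy (R : realType) (V : finType) := (nat -> V) -> nat -> V -> R.

Definition uniform_on (R : realType) (V : finType) (S : {set V}) (v : V) : R :=
  if v \in S then (#|S|%:R)^-1 else 0.

Definition pi_rw (R : realType) (V : finType) (e : rel V) : policy R V :=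
  fun x m => uniform_on R (neighbours e (x m)).

Definition traversals (V : finType) (x : nat -> V) (m : nat) (i j : V) : nat :=
  #|[set t : 'I_m | (x t == i) && (x t.+1 == j)]%SET|.

Definition Smin (V : finType) (e : rel V) (x : nat -> V) (m : nat) (i : V) :
    {set V} :=
  [set j in neighbours e i |
    [forall k in neighbours e i, (traversals x m i j <= traversals x m i k)%N]
  ]%SET.

Definition pi_neg (R : realType) (V : finType) (e : rel V) : policy R V :=
  fun x m => uniform_on R (Smin e x m (x m)).

Definition history (V : finType) (Omega : Type) (X : nat -> Omega -> V)
    (x : nat -> V) (m : nat) : set Omega :=
  [set w | forall t, (t <= m)%N -> X t w = x t].

Definition cond_prob (R : realType) (d : measure_display)
    (Omega : measurableType d) (P : probability Omega R) (A B : set Omega) :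
    \bar R :=
  (P (A `&` B) / P B)%E.

(* V is a finite discrete space, so measurability of X_m amounts to
   measurability of the events {X_m = v}. *)
Definition process_under (R : realType) (V : finType) (pi : policy R V) (v0 : V)
    (d : measure_display) (Omega : measurableType d) (P : probability Omega R)
    (X : nat -> Omega -> V) : Prop :=
  [/\ forall m v, measurable [set w | X m w = v],
      P [set w | X 0%N w = v0] = 1%E
    & forall (x : nat -> V) (m : nat) (v : V), P (history X x m) != 0%E ->
        cond_prob P [set w | X m.+1 w = v] (history X x m) = (pi x m v)%:E].

Definition visits_all (V : finType) (x : nat -> V) (m : nat) : Prop :=
  forall v : V, exists2 t : nat, (t <= m)%N & x t = v.

(* +oo when some node is never visited *)
Definition cover_time (R : realType) (V : finType) (x : nat -> V) : \bar R :=
  ereal_inf [set m%:R%:E | m in visits_all x].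

(* The library's 'E_P[_] only takes real-valued functions, whereas the cover
   time may be infinite. *)
Definition expected_cover_time (R : realType) (V : finType)
    (d : measure_display) (Omega : measurableType d) (P : probability Omega R)
    (X : nat -> Omega -> V) : \bar R :=
  (\int[P]_w cover_time R (fun m => X m w))%E.

Definition star (n : nat) : rel 'I_n.+1 :=
  fun i j => (i == ord0) && (j != ord0) || (i != ord0) && (j == ord0).

(* Main.v *)
(** Since E[T_C] is the sum over m of P(T_C > m), it suffices to find a
    potential phi on finite trajectories with
      phi(s) = 1{s misses a node} + E[phi(s X_{m+1}) | s]  and
      0 <= phi(s) <= C 1{s misses a node}:
    telescoping gives sum_(j < m) P(T_C > j) = phi(v0) - E[phi(X_0 ... X_m)],
    so the P(T_C > m) are summable, hence tend to 0, and the remainder, being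
    at most C P(T_C > m), vanishes in the limit.

    On the star, with k > 0 leaves still unvisited, phi is g(k) at a leaf and
    g(k) - 1 at the center.  A round trip from the center costs 2, so g must
    decrease by 2 on average.  The random walk meets a new leaf with
    probability k/n, whence g(k) = 2n(1 + ... + 1/k).  Under negative feedback
    the unvisited leaves are exactly those whose edge from the center has never
    been used, so every trip from the center meets a new leaf and g(k) = 2k. *)

Require Import Defs.
From mathcomp Require Import all_boot all_order all_algebra.
From mathcomp Require Import all_classical all_reals all_analysis.
From mathcomp Require Import measurable_realfun ring lra.

Set Implicit Arguments.
Unset Strict Implicit.
Unset Printing Implicit Defensive.

Import Order.TTheory GRing.Theory Num.Theory.
Import numFieldNormedType.Exports.
Local Open Scope classical_set_scope.
Local Open Scope ring_scope.

(** * Probabilities of finite trajectories *)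

Lemma sum_tuple_rcons (R : nmodType) (T : finType) (k : nat) (F : seq T -> R) :
  \sum_(t : k.+1.-tuple T) F t
  = \sum_(t : k.-tuple T) \sum_(x : T) F (rcons t x).
Proof.
rewrite pair_bigA /=.
have inj : injective (fun p : k.-tuple T * T => [tuple of rcons p.1 p.2]).
  move=> [t x] [u y] /(congr1 val) /= /rcons_inj [tu ->].
  by congr pair; apply: val_inj.
rewrite (reindex (fun p : k.-tuple T * T => [tuple of rcons p.1 p.2])) //=.
(* Both types have the same finite cardinality, so injectivity alone gives the bijection. *)
apply: onW_bij; apply: inj_card_bij => //.
by rewrite card_prod !card_tuple expnSr.
Qed.

Definition traj_prob (R : realType) (V : finType) (v0 : V)
    (d : measure_display) (Omega : measurableType d) (P : probability Omega R)
    (X : nat -> Omega -> V) (s : seq V) : R :=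
  fine (P (history X (nth v0 s) (size s).-1)).

Definition covers (V : finType) (s : seq V) : bool := [forall v, v \in s].

Lemma measurable_history (V : finType) (d : measure_display)
    (Omega : measurableType d) (X : nat -> Omega -> V) (x : nat -> V)
    (m : nat) :
  (forall m v, measurable [set w | X m w = v]) -> measurable (history X x m).
Proof.
move=> mX.
have -> : history X x m = \bigcap_(t in `I_m.+1) [set w | X t w = x t] by [].
by apply: bigcap_measurableType.
Qed.

Lemma history_rcons (V : finType) (v0 : V) (Omega : Type)
    (X : nat -> Omega -> V) (s : seq V) (v : V) : (0 < size s)%N ->
  history X (nth v0 (rcons s v)) (size (rcons s v)).-1
  = [set w | X (size s).-1.+1 w = v] `&` history X (nth v0 s) (size s).-1.
Proof.
move=> s0; rewrite size_rcons /= prednK //; apply/seteqP; split => w /=.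
  move=> h; split; first by rewrite h // nth_rcons ltnn eqxx.
  move=> t tm; have ts : (t < size s)%N by rewrite -(prednK s0).
  by rewrite h ?(ltnW ts) // nth_rcons ts.
move=> [hv h] t; rewrite leq_eqVlt => /predU1P[->|ts].
  by rewrite nth_rcons ltnn eqxx.
by rewrite nth_rcons ts h // -ltnS prednK.
Qed.

(** The chain rule. The conditional law constrains only histories of positive probability; on a null
    history both sides vanish, by monotonicity of [P]. *)
Lemma traj_prob_rcons (R : realType) (V : finType) (pi : policy R V) (v0 : V)
    (d : measure_display) (Omega : measurableType d) (P : probability Omega R)
    (X : nat -> Omega -> V) (s : seq V) (v : V) :
  process_under pi v0 P X -> (0 < size s)%N ->
  traj_prob v0 P X (rcons s v)
  = traj_prob v0 P X s * pi (nth v0 s) (size s).-1 v.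
Proof.
move=> [mX _ hX] s0; rewrite /traj_prob history_rcons //.
have mH := measurable_history (nth v0 s) (size s).-1 mX.
have mA := measurableI _ _ (mX (size s).-1.+1 v) mH.
have [H0|H0] := eqVneq (P (history X (nth v0 s) (size s).-1)) 0%E.
  rewrite H0 mul0r.
  by rewrite (@subset_measure0 _ _ _ P _ _ mA mH).
have := hX _ _ v H0; rewrite /cond_prob.
have /fineK <- := fin_num_measure P _ mA.
have /fineK := fin_num_measure P _ mH; move: H0.
set a := fine (P (_ `&` _)); set b := fine (P _) => H0 bE.
rewrite -bE in H0 *.
rewrite eqe in H0; rewrite inver (negbTE H0) -EFinM => -[<-].
by rewrite mulrC divfK.
Qed.

Lemma traj_prob_seq1 (R : realType) (V : finType) (pi : policy R V) (v0 : V)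
    (d : measure_display) (Omega : measurableType d) (P : probability Omega R)
    (X : nat -> Omega -> V) (v : V) :
  process_under pi v0 P X -> traj_prob v0 P X [:: v] = (v == v0)%:R.
Proof.
move=> [mX P0 _]; rewrite /traj_prob /=.
have -> : history X (nth v0 [:: v]) 0 = [set w | X 0%N w = v].
  apply/seteqP; split=> w /=; first by move=> h; rewrite h.
  by move=> h t; rewrite leqn0 => /eqP ->.
have [->|vv0] := eqVneq v v0; first by rewrite P0.
suff -> : P [set w | X 0%N w = v] = 0%E by [].
apply: (@subset_measure0 _ _ _ P _ (~` [set w | X 0%N w = v0])) => //.
- exact: measurableC.
- by move=> w /= -> /eqP; apply/negP.
- by apply: (etrans (probability_setC P (mX 0%N v0))); rewrite P0 subee.
Qed.

Lemma traj_prob_ge0 (R : realType) (V : finType) (v0 : V)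
    (d : measure_display) (Omega : measurableType d) (P : probability Omega R)
    (X : nat -> Omega -> V) (s : seq V) : 0 <= traj_prob v0 P X s.
Proof. exact: fine_ge0. Qed.

(** * Tail events of the cover time and the potential criterion *)

Lemma visits_allP (V : finType) (v0 : V) (x : nat -> V) (t : seq V) :
  (0 < size t)%N ->
  (forall i, (i <= (size t).-1)%N -> x i = nth v0 t i) ->
  visits_all x (size t).-1 <-> covers t.
Proof.
move=> t0 xt; split=> [h|/forallP h v].
  apply/forallP => v; have [i im <-] := h v.
  by rewrite xt // mem_nth // -(prednK t0).
have /(nthP v0)[i it <-] := h v.
have im : (i <= (size t).-1)%N by rewrite -ltnS prednK.
by exists i => //; exact: xt.
Qed.

(** Coverage by time [m] depends only on the first [m.+1] positions, so the event splits into
    finitely many histories; this yields its measurability and its probability. *)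
Lemma uncoveredE (V : finType) (v0 : V) (Omega : Type)
    (X : nat -> Omega -> V) (m : nat) :
  [set w | ~ visits_all (X^~ w) m]
  = \bigcup_(t in [set` (fun t : m.+1.-tuple V => ~~ covers t)])
       history X (nth v0 t) m.
Proof.
apply/seteqP; split=> w /=.
  move=> nv; exists [tuple X i w | i < m.+1]; last first.
    move=> i im.
    by rewrite (nth_mktuple _ v0 (Ordinal (im : (i < m.+1)%N))).
  apply/negP => c; apply: nv.
  have := @visits_allP V v0 (X^~ w) [tuple X i w | i < m.+1].
  rewrite size_tuple /= => h; apply/h => // i im.
  by rewrite (nth_mktuple _ v0 (Ordinal (im : (i < m.+1)%N))).
move=> [t /= /negP nc ht] v; apply: nc.
have := @visits_allP V v0 (X^~ w) t.
by rewrite size_tuple /= => h; apply/h.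
Qed.

Lemma measurable_uncovered (V : finType) (v0 : V) (d : measure_display)
    (Omega : measurableType d) (X : nat -> Omega -> V) (m : nat) :
  (forall m v, measurable [set w | X m w = v]) ->
  measurable [set w | ~ visits_all (X^~ w) m].
Proof.
move=> mX; rewrite (uncoveredE v0); apply: fin_bigcup_measurable.
  exact: finite_finpred.
by move=> t _; exact: measurable_history.
Qed.

Lemma prob_uncovered (R : realType) (V : finType) (v0 : V)
    (d : measure_display) (Omega : measurableType d) (P : probability Omega R)
    (X : nat -> Omega -> V) (m : nat) :
  (forall m v, measurable [set w | X m w = v]) ->
  P [set w | ~ visits_all (X^~ w) m]
  = (\sum_(t : m.+1.-tuple V) traj_prob v0 P X t * (~~ covers t)%:R)%:E.
Proof.
move=> mX; rewrite (uncoveredE v0) measure_fin_bigcup //=; first last.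
- by move=> t _; exact: measurable_history.
(* A point in two histories forces both tuples to agree with [X] entrywise, so distinct tuples have
   disjoint histories. *)
- move=> t u _ _ [w [ht hu]]; apply: val_inj; apply: (@eq_from_nth _ v0).
    by rewrite !size_tuple.
  by move=> i; rewrite size_tuple => im; rewrite -ht // -hu.
rewrite -(@bigfs _ _ _ _ (index_enum _)) ?index_enum_uniq // => [|t _];
  last first.
  by rewrite mem_index_enum.
rewrite -sumEFin [RHS]big_mkcond /= [LHS]big_mkcond; apply: eq_bigr => t _ /=.
case: (covers t) => /=; first by rewrite mulr0.
rewrite mulr1 /traj_prob size_tuple fineK //.
by apply: fin_num_measure; exact: measurable_history.
Qed.

Lemma visits_all_mono (V : finType) (x : nat -> V) (m k : nat) :
  (m <= k)%N -> visits_all x m -> visits_all x k.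
Proof.
by move=> mk h v; have [t tm <-] := h v; exists t => //; exact: leq_trans mk.
Qed.

(** The [m]-th term is the indicator of T_C > m, so the series counts the times before coverage. If
    coverage never happens, both sides are [+oo]. *)
Lemma cover_time_series (R : realType) (V : finType) (x : nat -> V) :
  cover_time R x
  = (\sum_(m <oo) (if `[< visits_all x m >] then 0 else 1))%E.
Proof.
apply/esym/cvg_lim => //.
have [[m vm]|nv] := pselect (exists m, visits_all x m); last first.
  have -> : cover_time R x = +oo%E.
    rewrite /cover_time (_ : (visits_all x : set nat) = set0).
      by rewrite image_set0 ereal_inf0.
    by apply/seteqP; split=> // m vm; apply: nv; exists m.
  rewrite (_ : (fun k => _) = (fun k : nat => (k%:R : R)%:E)).
    by apply/cvgeryP; exact: cvgr_idn.
  apply/funext => k; rewrite (eq_bigr (fun=> 1%E)) => [|i _]; last first.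
    by case: asboolP => // vi; case: nv; exists i.
  rewrite sumEFin big_const_nat subn0 iter_addr addr0 //.
pose p := fun k => `[< visits_all x k >].
have exp : exists k, p k by exists m; apply/asboolP.
case: (ex_minnP exp) => m0 /asboolP vm0 min0.
have -> : cover_time R x = m0%:R%:E.
  apply/eqP; rewrite eq_le; apply/andP; split.
    by apply: ereal_inf_lbound; exists m0.
  apply: le_ereal_inf_tmp => _ [k vk <-]; rewrite lee_fin ler_nat.
  by apply: min0; apply/asboolP.
(* Exactly the terms before the first covering time [m0] are 1, so the partial sums are constant
   from [m0] on. *)
apply: cvg_near_cst; exists m0 => // k /= m0k.
rewrite (big_cat_nat _ m0k) //= [X in (_ + X)%E]big_nat.
rewrite [X in (_ + X)%E]big1 ?adde0 => [|i]; last first.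
  case/andP=> mi _; case: asboolP => // -[]; exact: visits_all_mono vm0.
rewrite big_nat (eq_bigr (fun=> 1%E)) => [|i /= im]; last first.
  by case: asboolP => // /asboolP vi; have := min0 _ vi; rewrite leqNgt im.
by rewrite -big_nat sumEFin big_const_nat subn0 iter_addr addr0.
Qed.

(** Tonelli for nonnegative measurable indicators exchanges the integral and the series. *)
Lemma expected_cover_time_series (R : realType) (V : finType) (v0 : V)
    (d : measure_display) (Omega : measurableType d) (P : probability Omega R)
    (X : nat -> Omega -> V) :
  (forall m v, measurable [set w | X m w = v]) ->
  expected_cover_time P X
  = (\sum_(m <oo) (P [set w | ~ visits_all (X^~ w) m]))%E.
Proof.
move=> mX; rewrite /expected_cover_time.
have mU m := measurable_uncovered v0 m mX.
under eq_integral do rewrite cover_time_series.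
pose f m w : \bar R := (\1_[set w | ~ visits_all (X^~ w) m] w)%:E.
have fE m w : (if `[< visits_all (X^~ w) m >] then 0 else 1)%E = f m w.
  rewrite /f indicE; case: asboolP => h.
    by rewrite memNset // => /(_ h).
  by rewrite mem_set.
under eq_integral do under eq_eseriesr do rewrite fE.
rewrite integral_nneseries //=.
- by apply: eq_eseriesr => m _; rewrite integral_indic // setIT.
- by move=> m; apply/measurable_EFinP; exact: measurable_indic.
- by move=> m w _; rewrite lee_fin.
Qed.

(* The invariant I discards the trajectories of probability 0, on which the
   equation for phi may fail. *)
Lemma expected_cover_time_potential (R : realType) (V : finType)
    (pi : policy R V) (v0 : V) (I : seq V -> Prop) (phi : seq V -> R) (C : R)
    (d : measure_display) (Omega : measurableType d) (P : probability Omega R)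
    (X : nat -> Omega -> V) :
  process_under pi v0 P X ->
  I [:: v0] ->
  (forall s v, I s -> pi (nth v0 s) (size s).-1 v != 0 -> I (rcons s v)) ->
  (forall s, I s -> 0 <= phi s <= C * (~~ covers s)%:R) ->
  (forall s, I s ->
    phi s = (~~ covers s)%:R
      + \sum_v pi (nth v0 s) (size s).-1 v * phi (rcons s v)) ->
  expected_cover_time P X = (phi [:: v0])%:E.
Proof.
move=> hX I0 IS phi_bnd phiE; have [mX _ _] := hX.
pose a m : R := \sum_(t : m.+1.-tuple V) traj_prob v0 P X t * (~~ covers t)%:R.
pose b m : R := \sum_(t : m.+1.-tuple V) traj_prob v0 P X t * phi t.
(* Every trajectory of positive probability satisfies [I]: by the chain rule, both its prefix and
   its last transition then have nonzero probability. *)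
have IP m (t : m.+1.-tuple V) : traj_prob v0 P X t != 0 -> I t.
  elim: m t => [|m IH] t.
    case/tupleP: t => v t; rewrite (tuple0 t) /=.
    rewrite (traj_prob_seq1 _ hX).
    by case: (eqVneq v v0) => [->//|_]; rewrite eqxx.
  case/tupleP: t => v t; rewrite /= lastI.
  have ts : (0 < size (belast v t))%N by rewrite size_belast size_tuple.
  rewrite (traj_prob_rcons _ hX) // mulf_eq0 negb_or => /andP[h1 h2].
  apply: IS => //.
  have st : size (belast v t) == m.+1 by rewrite size_belast size_tuple.
  exact: (IH (Tuple st)).
(* The equation for [phi], weighted by [traj_prob] and summed; null trajectories contribute 0 to
   both sides. *)
have bS m : b m = a m + b m.+1.
  rewrite /b (sum_tuple_rcons m.+1 (fun s => traj_prob v0 P X s * phi s)).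
  rewrite -big_split /=; apply: eq_bigr => t _.
  have [t0|t0] := eqVneq (traj_prob v0 P X t) 0.
    rewrite t0 !mul0r add0r big1 // => v _.
    by rewrite (traj_prob_rcons _ hX) ?size_tuple // t0 !mul0r.
  rewrite phiE; last exact: IP.
  rewrite mulrDr mulr_sumr; congr (_ + _); apply: eq_bigr => v _.
  by rewrite (traj_prob_rcons _ hX) ?size_tuple // mulrA.
have b0 : b 0%N = phi [:: v0].
  rewrite /b (sum_tuple_rcons _ (fun s => traj_prob v0 P X s * phi s)).
  rewrite (bigD1 [tuple]) //= [X in _ + X]big1 => [|t /eqP[]];
    last exact: tuple0.
  rewrite addr0 (bigD1 v0) //= [X in _ + X]big1 => [|v /negPf vv0].
    by rewrite (traj_prob_seq1 _ hX) eqxx mul1r addr0.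
  by rewrite (traj_prob_seq1 _ hX) vv0 mul0r.
have a_ge0 m : 0 <= a m.
  by apply: sumr_ge0 => t _; rewrite mulr_ge0 ?traj_prob_ge0.
have b_bnd m : 0 <= b m <= C * a m.
  rewrite sumr_ge0 /= => [|t _].
    rewrite /a mulr_sumr; apply: ler_sum => t _.
    have [->|/IP/phi_bnd/andP[_ h]] := eqVneq (traj_prob v0 P X t) 0.
      by rewrite !mul0r mulr0.
    by rewrite mulrCA ler_wpM2l ?traj_prob_ge0.
  have [->|/IP/phi_bnd/andP[h _]] := eqVneq (traj_prob v0 P X t) 0.
    by rewrite mul0r.
  by rewrite mulr_ge0 ?traj_prob_ge0.
have partial m : series a m = phi [:: v0] - b m.
  elim: m => [|m IH]; first by rewrite /series /= big_geq // b0 subrr.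
  rewrite /series /= big_nat_recr //= -[X in X + _]/(series a m) IH bS.
  by rewrite opprD addrA addrAC subrK.
(* The partial sums of [a] are nondecreasing, and bounded by [phi [:: v0]] because [b] is
   nonnegative. *)
have cvg_a : a @ \oo --> (0 : R).
  apply: cvg_series_cvg_0; apply: nondecreasing_is_cvgn.
    apply/nondecreasing_seqP => m.
    by rewrite /series /= big_nat_recr //= lerDl.
  exists (phi [:: v0]) => _ [m _ <-]; rewrite partial gerBl.
  by have /andP[] := b_bnd m.
have cvg_b : b @ \oo --> (0 : R).
  apply: (@squeeze_cvgr _ _ _ _ (fun=> 0) (fun m => C * a m)).
  - by near=> m; exact: b_bnd.
  - exact: cvg_cst.
  - by rewrite -(mulr0 C); apply: cvgMr.
rewrite (expected_cover_time_series v0) //.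
under eq_eseriesr do rewrite (prob_uncovered v0) //.
apply: cvg_lim => //.
rewrite (_ : (fun k => _) = (fun k => (phi [:: v0] - b k)%:E)); last first.
  by apply/funext => k; rewrite sumEFin -partial.
apply: cvg_EFin; first by near=> k.
rewrite -[X in _ --> X]subr0.
by apply: cvgB; [exact: cvg_cst | exact: cvg_b].
Unshelve. all: by end_near. Qed.

(** * Walks on the star graph *)

Definition unvisited (V : finType) (s : seq V) : nat := #|[predC s]|.

Lemma covers_unvisited (V : finType) (s : seq V) :
  covers s = (unvisited s == 0)%N.
Proof.
apply/forallP/eqP => [h|/card0_eq h v].
  by apply: eq_card0 => v; rewrite !inE h.
by have := h v; rewrite !inE => /negbFE.
Qed.

Lemma unvisited_rcons (V : finType) (s : seq V) (v : V) :
  unvisited (rcons s v) = (unvisited s - (v \notin s))%N.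
Proof.
rewrite /unvisited; case: (boolP (v \in s)) => vs /=.
  rewrite subn0; apply: eq_card => u; rewrite !inE mem_rcons inE.
  by case: eqVneq => [->|//]; rewrite vs.
rewrite [in RHS](cardD1 v) !inE vs addKn; apply: eq_card => u.
by rewrite !inE mem_rcons inE negb_or.
Qed.

(** The trajectory invariant for the star. Starting at the center puts [ord0] among the visited
    nodes, so only leaves can be unvisited. *)
Definition star_walk (n : nat) (s : seq 'I_n.+1) : bool :=
  if s is x :: t then (x == ord0) && path (@star n) x t else false.

Lemma neighbours_leaf (n : nat) (i : 'I_n.+1) : i != ord0 ->
  neighbours (@star n) i = [set ord0]%SET.
Proof. by move=> i0; apply/setP => j; rewrite !inE /star (negPf i0). Qed.

Lemma neighbours_center (n : nat) :
  neighbours (@star n) ord0 = [set~ ord0]%SET.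
Proof. by apply/setP => j; rewrite !inE /star eqxx orbF. Qed.

Lemma star_walk_rcons (n : nat) (s : seq 'I_n.+1) (v : 'I_n.+1) :
  star_walk s -> v \in neighbours (@star n) (last ord0 s) ->
  star_walk (rcons s v).
Proof.
by case: s => //= x t /andP[-> xt]; rewrite rcons_path inE xt.
Qed.

Lemma center_visited (n : nat) (s : seq 'I_n.+1) : star_walk s -> ord0 \in s.
Proof. by case: s => //= x t /andP[/eqP-> _]; rewrite inE eqxx. Qed.

Lemma sum_uniform_on (R : realType) (V : finType) (S : {set V}) (f : V -> R) :
  \sum_v uniform_on R S v * f v = (#|S|%:R)^-1 * \sum_(v in S) f v.
Proof.
rewrite mulr_sumr [RHS]big_mkcond /=; apply: eq_bigr => v _.
by rewrite /uniform_on; case: ifP => // _; rewrite mul0r.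
Qed.

(* S s is the set of nodes that the policy may choose after the trajectory s.
   The last hypothesis on g says that g loses 2 on average per departure from
   the center: only the unvisited leaves in S s decrease the argument. *)
Lemma star_expected_cover_time (R : realType) (n : nat)
    (pi : policy R 'I_n.+1) (S : seq 'I_n.+1 -> {set 'I_n.+1}) (g : nat -> R)
    (d : measure_display) (Omega : measurableType d) (P : probability Omega R)
    (X : nat -> Omega -> 'I_n.+1) :
  (0 < n)%N ->
  (forall s v, star_walk s ->
     pi (nth ord0 s) (size s).-1 v = uniform_on R (S s) v) ->
  (forall s, S s \subset neighbours (@star n) (last ord0 s)) ->
  (forall s, (0 < #|S s|)%N) ->
  g 0%N = 0 -> (forall k, 1 <= g k.+1) ->
  (forall s, star_walk s -> last ord0 s = ord0 -> ~~ covers s ->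
     #|S s :\: [set v in s]|%SET%:R * (g (unvisited s) - g (unvisited s).-1)
     = 2 * #|S s|%:R) ->
  process_under pi ord0 P X ->
  expected_cover_time P X = (g n - 1)%:E.
Proof.
move=> n0 piE Sn S0 g0 g1 gS hX.
(* The value is set to 0 after coverage, where the second formula would give -1 at the center. *)
pose phi (s : seq 'I_n.+1) : R := if covers s then 0
                  else g (unvisited s) - (last ord0 s == ord0)%:R.
have g_ge0 k : 0 <= g k by case: k => [|k]; [rewrite g0|exact: le_trans (g1 k)].
have u1 : unvisited [:: ord0 : 'I_n.+1] = n.
  rewrite /unvisited -[RHS]/(n.+1.-1) -[X in _ = X.-1]card_ord.
  by rewrite -(cardC1 (ord0 : 'I_n.+1)); apply: eq_card => v; rewrite !inE.
have -> : g n - 1 = phi [:: ord0].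
  by rewrite /phi covers_unvisited u1 eqn0Ngt n0.
(* Since [g] is nonnegative and [unvisited s < n.+2], the sum of all these values of [g] serves as
   the uniform constant [C]. *)
apply: (@expected_cover_time_potential _ _ pi ord0 (@star_walk n) phi
  (\sum_(k < n.+2) g k)) => //.
- move=> s v ws; rewrite piE // /uniform_on; case: ifP; last by rewrite eqxx.
  by move=> vS _; apply: star_walk_rcons => //; exact: (fintype.subsetP (Sn s)).
- move=> s ws; rewrite /phi; case: ifPn => cs; first by rewrite mulr0 lexx.
  have us : (0 < unvisited s)%N by rewrite lt0n -covers_unvisited.
  have us' : (unvisited s < n.+2)%N.
    by rewrite ltnS -[n.+1 in leqRHS]card_ord max_card.
  have gu : 1 <= g (unvisited s) by rewrite -(prednK us).
  rewrite mulr1 (bigD1 (Ordinal us')) //=.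
  have sum0 : 0 <= \sum_(i < n.+2 | i != Ordinal us') g i.
    exact: sumr_ge0.
  by case: (last _ _ == _) => /=; lra.
- move=> s ws; under eq_bigr do rewrite piE //.
  rewrite sum_uniform_on.
  have cR v : covers s -> covers (rcons s v).
    by rewrite !covers_unvisited unvisited_rcons => /eqP ->.
  rewrite {1}/phi; case: ifPn => cs.
    by rewrite add0r big1 ?mulr0 // => v _; rewrite /phi cR.
  have us : (0 < unvisited s)%N by rewrite lt0n -covers_unvisited.
  have Sr : #|S s|%:R != 0 :> R by rewrite pnatr_eq0 -lt0n.
  (* At a leaf the only move is back to the already visited center: the unvisited count stays and
     [phi] drops by exactly 1. *)
  have [l0|l0] := eqVneq (last ord0 s) ord0; last first.
    have SE : S s = [set ord0]%SET.
      have := Sn s; rewrite neighbours_leaf // finset.subset1.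
      by case/orP=> [/eqP//|/eqP E]; have := S0 s; rewrite E cards0.
    rewrite SE cards1 big_set1 invr1 mul1r /phi covers_unvisited.
    rewrite unvisited_rcons center_visited // subn0 -covers_unvisited.
    by rewrite (negPf cs) last_rcons eqxx /=; ring.
  (* From the center, a new leaf replaces g(k) by g(k-1), with k the unvisited count; if it
     completes the coverage, g(0) = 0 matches the value of [phi] there. *)
  have phiR v : v \in S s ->
      phi (rcons s v)
      = g (unvisited s)
        - (v \notin s)%:R * (g (unvisited s) - g (unvisited s).-1).
    move=> /(fintype.subsetP (Sn s)); rewrite l0 neighbours_center !inE => v0.
    rewrite /phi last_rcons (negPf v0) subr0 covers_unvisited unvisited_rcons.
    case: (v \in s) => /=.
      by rewrite subn0 -covers_unvisited (negPf cs) mul0r subr0.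
    rewrite subn1 mul1r; case: ifP => [/eqP ->|_]; rewrite ?g0; ring.
  rewrite (eq_bigr _ phiR) sumrB sumr_const -mulr_suml -natr_sum.
  have -> : (\sum_(v in S s) (v \notin s))%N = #|S s :\: [set v in s]|%SET.
    rewrite -sum1_card big_mkcond [RHS]big_mkcond; apply: eq_bigr => v _.
    by rewrite !inE; case: (v \in S s); case: (v \in s).
  (* The average after the step is g(k) - 2, and g(k) - 1 = 1 + (g(k) - 2). *)
  by rewrite gS // -[_ *+ #|S s|]mulr_natr /=; field.
Qed.

(** * Negative feedback on the star *)

(** A leaf can only be entered from the center, so visiting it means traversing its edge from there.
    The bound [(size s).-1] takes in every step of [s]. *)
Lemma traversals_center (n : nat) (s : seq 'I_n.+1) (v : 'I_n.+1) :
  star_walk s -> v != ord0 ->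
  (traversals (nth ord0 s) (size s).-1 ord0 v == 0)%N = (v \notin s).
Proof.
case: s => //= x t /andP[/eqP-> /(pathP ord0) walk] v0.
rewrite /traversals cards_eq0; apply/eqP/idP => [E|vt].
  apply/negP; rewrite inE (negPf v0) /= => /(nthP ord0)[i it iv].
  move/setP: E => /(_ (Ordinal it)); rewrite !inE /= iv eqxx andbT.
  by have := walk _ it; rewrite /= iv /star (negPf v0) andbF orbF => /andP[->].
apply/setP => i; rewrite !inE; apply/negP => /andP[_ /eqP iv]; case/negP: vt.
by rewrite -iv /= inE mem_nth ?orbT //; exact: ltn_ord.
Qed.

(** Some leaf is unvisited, so the minimal traversal count is 0, attained exactly at the unvisited
    leaves. *)
Lemma Smin_center (n : nat) (s : seq 'I_n.+1) :
  star_walk s -> ~~ covers s ->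
  Smin (@star n) (nth ord0 s) (size s).-1 ord0 = [set v | v \notin s]%SET.
Proof.
move=> ws /forallPn[u us].
have out v : v \notin s -> v != ord0.
  by apply: contraNneq => ->; exact: center_visited.
have trE := traversals_center ws.
rewrite /Smin neighbours_center; apply/setP => v; rewrite !inE.
apply/andP/idP => [[v0 /'forall_implyP/(_ u)]|vs].
  rewrite !inE out // => /(_ isT).
  by have := trE u (out _ us); rewrite us => /eqP ->; rewrite leqn0 trE.
split; first exact: out.
apply/'forall_implyP => w _.
by have := trE v (out _ vs); rewrite vs => /eqP ->.
Qed.

Lemma Smin_subset (V : finType) (e : rel V) (x : nat -> V) (m : nat) (i : V) :
  Smin e x m i \subset neighbours e i.
Proof. by apply/fintype.subsetP => j; rewrite /Smin inE => /andP[]. Qed.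

Lemma card_Smin_gt0 (V : finType) (e : rel V) (x : nat -> V) (m : nat)
    (i j : V) :
  e i j -> (0 < #|Smin e x m i|)%N.
Proof.
move=> ij; have jN : j \in neighbours e i by rewrite inE.
apply/card_gt0P; exists [arg min_(k < j in neighbours e i) traversals x m i k].
case: arg_minnP => // k kN kmin; rewrite /Smin inE kN /=; apply/forallP => w.
by apply/implyP => wN; have := kmin _ wN.
Qed.

Lemma star_neighbour (n : nat) (i : 'I_n.+1) : (0 < n)%N ->
  exists j, @star n i j.
Proof.
move=> n0; have [->|i0] := eqVneq i ord0; last first.
  by exists ord0; rewrite /star (negPf i0).
by exists ord_max; rewrite /star /= -val_eqE /= -lt0n n0.
Qed.

Lemma star_cover_time_neg (R : realType) (n : nat)
    (d : measure_display) (Omega : measurableType d) (P : probability Omega R)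
    (X : nat -> Omega -> 'I_n.+1) :
  (0 < n)%N -> process_under (pi_neg R (@star n)) ord0 P X ->
  expected_cover_time P X = (2 * n%:R - 1)%:E.
Proof.
move=> n0 hX.
apply: (@star_expected_cover_time R n _
  (fun s => Smin (@star n) (nth ord0 s) (size s).-1 (last ord0 s))
  (fun k => 2 * k%:R) _ _ _ _ n0 _ _ _ _ _ _ hX) => /=.
- by move=> s v _; rewrite /pi_neg nth_last.
- by move=> s; exact: Smin_subset.
- move=> s; have [j] := star_neighbour (last ord0 s) n0; exact: card_Smin_gt0.
- by rewrite mulr0.
- by move=> k; rewrite -natrM ler1n.
(* Every admissible leaf is new, and reaching it lowers [g] by 2. *)
- move=> s ws -> cs; rewrite Smin_center //.
  have -> : [set v | v \notin s]%SET :\: [set v in s]%SET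
            = [set v | v \notin s]%SET.
    by apply/setP => v; rewrite !inE andbb.
  have : (0 < unvisited s)%N by rewrite lt0n -covers_unvisited.
  case: (unvisited s) => // k _ /=; rewrite -[k.+1]addn1 natrD; ring.
Qed.

(** * The random walk on the star *)

Lemma star_cover_time_rw (R : realType) (n : nat)
    (d : measure_display) (Omega : measurableType d) (P : probability Omega R)
    (X : nat -> Omega -> 'I_n.+1) :
  (0 < n)%N -> process_under (pi_rw R (@star n)) ord0 P X ->
  expected_cover_time P X
    = (2 * n%:R * (\sum_(1 <= i < n.+1) i%:R^-1) - 1)%:E.
Proof.
move=> n0 hX.
apply: (@star_expected_cover_time R n _
  (fun s => neighbours (@star n) (last ord0 s))
  (fun k => 2 * n%:R * (\sum_(1 <= i < k.+1) i%:R^-1))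
  _ _ _ _ n0 _ _ _ _ _ _ hX) => /=.
- by move=> s v _; rewrite /pi_rw nth_last.
- by [].
- move=> s; have [j sj] := star_neighbour (last ord0 s) n0.
  by apply/card_gt0P; exists j; rewrite inE.
- by rewrite big_geq // mulr0.
(* The term i = 1 of the harmonic sum already gives at least 2n. *)
- move=> k; rewrite big_nat_recl // invr1.
  have n1 : 1 <= n%:R :> R by rewrite ler1n.
  have : 0 <= \sum_(1 <= i < k.+1) (i.+1%:R^-1 : R).
    by apply: sumr_ge0 => i _; rewrite invr_ge0.
  nra.
(* With k of the n leaves unvisited, a new leaf lowers [g] by 2n/k, and k times 2n/k is 2n. *)
- move=> s ws -> cs; rewrite neighbours_center cardsC1 card_ord /=.
  have -> : #|[set~ ord0]%SET :\: [set v in s]%SET| = unvisited s.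
    apply: eq_card => v; rewrite !inE andb_idr //.
    by apply: contraNneq => ->; exact: center_visited.
  have : (0 < unvisited s)%N by rewrite lt0n -covers_unvisited.
  case: (unvisited s) => // k _ /=; rewrite [X in _ * X - _]big_nat_recr //=.
  by field; rewrite addrC natr1 pnatr_eq0.
Qed.

Theorem theorem3 (R : realType) (n : nat) (hn : (2 <= n)%N) :
  [/\ forall (d : measure_display) (Omega : measurableType d)
        (P : probability Omega R) (X : nat -> Omega -> 'I_n.+1),
        process_under (pi_neg R (@star n)) ord0 P X ->
        expected_cover_time P X = (2 * n%:R - 1)%:E,
      forall (d : measure_display) (Omega : measurableType d)
        (P : probability Omega R) (X : nat -> Omega -> 'I_n.+1),
        process_under (pi_rw R (@star n)) ord0 P X ->
        expected_cover_time P X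
          = (2 * n%:R * (\sum_(1 <= i < n.+1) i%:R^-1) - 1)%:E
    & forall (d d' : measure_display) (Omega : measurableType d)
        (Omega' : measurableType d') (P : probability Omega R)
        (P' : probability Omega' R) (X : nat -> Omega -> 'I_n.+1)
        (Y : nat -> Omega' -> 'I_n.+1),
        process_under (pi_neg R (@star n)) ord0 P X ->
        process_under (pi_rw R (@star n)) ord0 P' Y ->
        (expected_cover_time P X < expected_cover_time P' Y)%E].
Proof.
have n0 : (0 < n)%N by exact: ltnW.
split=> [d Omega P X|d Omega P X|d d' Omega Omega' P P' X Y hX hY].
- exact: star_cover_time_neg.
- exact: star_cover_time_rw.
rewrite (star_cover_time_neg n0 hX) (star_cover_time_rw n0 hY) lte_fin ltrD2r.
(* It remains to see that the harmonic sum exceeds 1, which its term 1/2, present as n >= 2,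
   ensures. *)
rewrite ltr_pMr ?mulr_gt0 ?ltr0n // big_ltn // invr1 ltrDl big_ltn //.
rewrite ltr_wpDr ?invr_gt0 ?ltr0n //.
by apply: sumr_ge0 => i _; rewrite invr_ge0.
Qed.
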